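(* The cluster numbers $s_{n,k}$ for the consecutive pattern $14523$ satisfy the recurrence \[s_{n,k} = \sum_{\ell:\ 5 \leq 3\ell+2 \leq n} \binom{n-\ell-2}{2\ell}\,(2\ell-1)!!\; s_{n-3\ell-1,\,k-\ell} \quad \text{for } n\geq 5,\] with the initial conditions $s_{n,k}=0$ for $n<5$, except $s_{1,0}=1$.
   Context: For a consecutive pattern $\sigma$ of length $m$ (here $\sigma=14523$, $m=5$): an occurrence of $\sigma$ in a permutation is a block of $m$ consecutive positions whose entries are in the same relative order as $\sigma$. A $k$-cluster of length $n\ge m$ is a permutation of $\{1,\dots,n\}$ containing precisely $k$ occurrences of $\sigma$, such that every entry belongs to at least one occurrence and any two successive occurrences overlap in at least one position. $s_{n,k}$ is the number of $k$-clusters of length $n$. $(2\ell-1)!!=1\cdot3\cdot5\cdots(2\ell-1)$. *)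

(* Defs.v *)
From mathcomp Require Import all_boot all_fingroup.
Set Implicit Arguments.
Unset Strict Implicit.
Unset Printing Implicit Defensive.

Definition sigma : seq nat := [:: 1; 4; 5; 2; 3].

(* One-line notation of a permutation p of {0,..,n-1} (relative order is all
   that matters, so 0-based values are as good as {1,..,n}). *)
Definition word n (p : 'S_n) : seq nat := [seq val (p j) | j <- enum 'I_n].

Definition occ_at (w : seq nat) (i : nat) : bool :=
  (i + 5 <= size w) &&
  [forall a : 'I_5, forall b : 'I_5,
     (nth 0 w (i + a) < nth 0 w (i + b)) == (nth 0 sigma a < nth 0 sigma b)].

Definition occs (w : seq nat) : seq nat := [seq i <- iota 0 (size w) | occ_at w i].

Definition is_cluster (k : nat) (w : seq nat) : bool :=
  [&& size (occs w) == k,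
      all (fun j => has (fun i => (i <= j) && (j < i + 5)) (occs w)) (iota 0 (size w))
    & sorted (fun i i' => i' < i + 5) (occs w)].

(* Number of k-clusters of length n (meaningful for n >= 5). *)
Definition cluster_count (n k : nat) : nat := #|[set p : 'S_n | is_cluster k (word p)]|.

Definition s (n k : nat) : nat :=
  if n < 5 then ((n == 1) && (k == 0) : nat) else cluster_count n k.

Definition odd_dfact (l : nat) : nat := \prod_(i < l) (2 * i + 1).

(* Main.v *)
Require Import Defs.
From mathcomp Require Import all_boot all_fingroup zify.
Set Implicit Arguments.
Unset Strict Implicit.
Unset Printing Implicit Defensive.

(** Two occurrences of 14523 can only overlap at distance 3 or 4, so a cluster
    starts with a run of [l >= 1] occurrences at positions [0, 3, ..., 3(l-1)],
    after which it either ends (at length [3l+2]) or continues at distance 4 with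
    a smaller cluster sharing the entry [w_(3l+1)].  In such a word the
    inequalities of the pattern read
      [w_0 < w_3 < ... < w_(3l) < w_(3l+1)],
      [w_(3l+1) < w_(3l-2) < ... < w_4 < w_1]  and  [w_(3i+1) < w_(3i+2)],
    and a cluster starts with its minimum, so the [l+2] smallest values are forced.
    The other [n-l-2] values are split freely into the [2l] entries at positions
    [3i+1, 3i+2], which form a perfect matching listed by decreasing minimum, and
    the remaining entries of the smaller cluster. *)

(** * Counting permutations by the set of their first entries *)

Lemma count_bij (T U : eqType) (f : U -> T) (P : pred T) (Q : pred U) r t :
    uniq r -> uniq t ->
    {in [seq y <- t | Q y] &, injective f} ->
    (forall y, y \in t -> Q y -> (f y \in r) && P (f y)) ->
    (forall x, x \in r -> P x -> exists2 y, (y \in t) && Q y & x = f y) ->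
  count P r = count Q t.
Proof.
move=> Ur Ut If Hf Hs; rewrite -!size_filter -(size_map f).
apply: perm_size; apply: uniq_perm; rewrite ?filter_uniq //.
  by rewrite map_inj_in_uniq ?filter_uniq.
move=> x; apply/idP/mapP => [|[y]].
  rewrite mem_filter => /andP[Px xr].
  by have [y /andP[yt Qy] ->] := Hs _ xr Px; exists y; rewrite // mem_filter Qy.
by rewrite mem_filter => /andP[Qy yt] ->; rewrite mem_filter andbC Hf.
Qed.

Lemma count_sum (T : Type) (P : pred T) r : count P r = \sum_(x <- r) P x.
Proof. by rewrite -sum1_count big_mkcond; apply: eq_bigr => x _; case: (P x). Qed.

(** Listing the choices explicitly makes the binomial coefficient a length and lets a sum over
    choices be exchanged with a sum over permutations. *)
Fixpoint splits (T : Type) a (A : seq T) : seq (seq T * seq T) :=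
  match a, A with
  | 0, _ => [:: ([::], A)]
  | a'.+1, [::] => [::]
  | a'.+1, x :: A' => [seq (x :: BC.1, BC.2) | BC <- splits a' A'] ++
                      [seq (BC.1, x :: BC.2) | BC <- splits a A']
  end.

Lemma size_splits (T : Type) a (A : seq T) : size (splits a A) = 'C(size A, a).
Proof.
elim: A a => [|x A IH] [|a] //=.
by rewrite size_cat !size_map !IH binS addnC.
Qed.

Lemma mem_splits (T : eqType) a (A : seq T) BC : BC \in splits a A ->
  (size BC.1 == a) && perm_eq (BC.1 ++ BC.2) A.
Proof.
elim: A a BC => [|x A IH] [|a] BC //=.
- by rewrite inE => /eqP->.
- by rewrite inE => /eqP->; rewrite /= perm_refl.
rewrite mem_cat => /orP[] /mapP[[B C] /IH/= /andP[/eqP sB pe] ->] /=.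
  by rewrite sB eqxx perm_cons.
by rewrite sB eqxx -cat_rcons -cats1 -catA perm_catCA perm_cons.
Qed.

(** Both parts of a splitting keep the order of [A], so a set of chosen entries arises from one
    splitting only: each [x] goes left exactly when [x] is in [u]. *)
Lemma count_splits (T : eqType) (A u : seq T) : uniq A -> uniq u ->
    {subset u <= A} ->
  count (fun BC => perm_eq u BC.1) (splits (size u) A) = 1.
Proof.
elim: A u => [|x A IH] [|y u'] //=.
  by move=> _ _ /(_ y); rewrite mem_head => /(_ isT).
set u := y :: u' => /andP[xA UA] Uu sub.
rewrite count_cat !count_map -[(size u').+1]/(size u).
have [xu|xu] := boolP (x \in u).
  rewrite [X in _ + X](_ : _ = 0).
    rewrite addn0 -(IH (rem x u)) ?rem_uniq //.
      rewrite size_rem //=; apply: eq_count => -[B C] /=.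
      by rewrite (permPl (perm_to_rem xu)) perm_cons.
    move=> z; rewrite mem_rem_uniq // inE => /andP[/= zx /sub].
    by rewrite inE (negPf zx).
  apply/eqP; rewrite -leqn0 leqNgt -has_count; apply/hasP => -[[B C]] /=.
  move=> /mem_splits/= /andP[_ pe] pe'; case/negP: xA.
  by rewrite -(perm_mem pe) mem_cat -(perm_mem pe') xu.
rewrite [X in X + _](_ : _ = 0).
  rewrite add0n -(IH u) // => z zu; have := sub _ zu.
  by rewrite inE => /orP[/eqP zx|//]; rewrite -zx zu in xu.
apply/eqP; rewrite -leqn0 leqNgt -has_count; apply/hasP => -[[B C]] /= _ pe.
by move: xu; rewrite (perm_mem pe) mem_head.
Qed.

Lemma count_permutations_cat (T : eqType) (A B C : seq T) (P Q : pred (seq T)) :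
    uniq A -> perm_eq (B ++ C) A ->
  count (fun w => [&& perm_eq (take (size B) w) B, P (take (size B) w)
                    & Q (drop (size B) w)]) (permutations A) =
  count P (permutations B) * count Q (permutations C).
Proof.
move=> UA pe; have UBC : uniq (B ++ C) by rewrite (perm_uniq pe).
rewrite -!size_filter -(size_allpairs cat); apply: perm_size.
apply: uniq_perm; first by rewrite filter_uniq ?permutations_uniq.
  apply: allpairs_uniq; rewrite ?filter_uniq ?permutations_uniq //.
  move=> [u v] [u' v'] /allpairsP[[a b] /= []]; rewrite !mem_filter !mem_permutations.
  move=> /andP[_ /perm_size su] _ [-> _].
  move=> /allpairsP[[a' b'] /= []]; rewrite !mem_filter !mem_permutations.
  move=> /andP[_ /perm_size su'] _ [-> _] /eqP; rewrite eqseq_cat ?su ?su' //.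
  by move=> /andP[/eqP-> /eqP->].
move=> w; rewrite mem_filter mem_permutations; apply/idP/allpairsP.
  case/andP=> /and3P[p1 HP HQ] pw; exists (take (size B) w, drop (size B) w).
  rewrite /= !mem_filter !mem_permutations HP HQ p1 cat_take_drop; split=> //=.
  rewrite -(perm_cat2l B) (perm_trans _ (perm_trans pw _)) //; last by rewrite perm_sym.
  by rewrite -{2}(cat_take_drop (size B) w) perm_cat2r perm_sym.
move=> [[u v] /= []]; rewrite !mem_filter !mem_permutations.
move=> /andP[HP pu] /andP[HQ pv] ->.
rewrite -(perm_size pu) take_size_cat // drop_size_cat // HP HQ pu /=.
by apply: perm_trans pe; apply: perm_cat.
Qed.

(** The source of the binomial coefficient: permutations are classified by the set of their first
    [a] entries, and every class contributes the same product [p * q]. *)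
Lemma count_permutations_split (T : eqType) (A : seq T) a (P Q : pred (seq T)) p q :
    uniq A ->
    (forall B C, perm_eq (B ++ C) A -> size B = a ->
       count P (permutations B) = p /\ count Q (permutations C) = q) ->
  a <= size A ->
  count (fun w => P (take a w) && Q (drop a w)) (permutations A) =
  'C(size A, a) * p * q.
Proof.
move=> UA H aA.
transitivity (\sum_(BC <- splits a A) p * q); last first.
  by rewrite big_const_seq count_predT size_splits iter_addn_0 mulnC mulnA.
transitivity (\sum_(w <- permutations A) \sum_(BC <- splits a A)
   [&& perm_eq (take a w) BC.1, P (take a w) & Q (drop a w)]).
  rewrite count_sum [LHS]big_seq [RHS]big_seq; apply: eq_bigr => w.
  rewrite mem_permutations => pw.
  have st : size (take a w) = a by rewrite size_takel // (perm_size pw).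
  case E: (P _ && _); last by rewrite big1 // => BC _; rewrite andbF.
  transitivity (count (fun BC => perm_eq (take a w) BC.1) (splits a A)).
    rewrite -{2}st count_splits ?take_uniq ?(perm_uniq pw) // => z /mem_take.
    by rewrite (perm_mem pw).
  by rewrite count_sum; apply: eq_bigr => BC _; rewrite andbT.
rewrite exchange_big /= [LHS]big_seq [RHS]big_seq; apply: eq_bigr => -[B C].
move=> /mem_splits/= /andP[/eqP sB pe]; have [<- <-] := H _ _ pe sB.
by rewrite -(count_permutations_cat _ _ UA pe) count_sum sB.
Qed.

(** * Overlapping occurrences and the peeling of clusters *)

Lemma occ_atE w i : occ_at w i =
  [&& i + 5 <= size w, nth 0 w i < nth 0 w (i + 3), nth 0 w (i + 3) < nth 0 w (i + 4),
      nth 0 w (i + 4) < nth 0 w (i + 1) & nth 0 w (i + 1) < nth 0 w (i + 2)].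
Proof.
rewrite /occ_at; case: leq => //=.
have five (a : 'I_5) : [\/ val a = 0, val a = 1, val a = 2 | val a = 3] \/ val a = 4.
  by case: a => -[|[|[|[|[|]]]]] //= _; [left; constructor 1|left; constructor 2
    |left; constructor 3|left; constructor 4|right].
apply/idP/idP => [/'forall_forallP H|/and4P[h1 h2 h3 h4]].
  have h a b (la : a < 5) (lb : b < 5) := eqP (H (Ordinal la) (Ordinal lb)).
  have := h 0 3 isT isT; have := h 3 4 isT isT; have := h 4 1 isT isT.
  have := h 1 2 isT isT; rewrite /= addn0.
  by move=> -> -> -> ->.
apply/'forall_forallP => a b; apply/eqP.
by case: (five a) => [[]|] ->; case: (five b) => [[]|] ->; rewrite ?addn0 /=; lia.
Qed.

Lemma occ_at_drop d w i : occ_at (drop d w) i = occ_at w (d + i).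
Proof. by rewrite !occ_atE size_drop !nth_drop !addnA; congr andb; lia. Qed.

Lemma occs_drop d w : d <= size w ->
  occs w = [seq i <- iota 0 d | occ_at w i] ++ map (addn d) (occs (drop d w)).
Proof.
move=> le; rewrite /occs -{1}(subnKC le) iotaD filter_cat; congr (_ ++ _).
rewrite size_drop add0n -{1}[d]addn0 iotaDl filter_map; congr map.
by apply: eq_filter => i /=; rewrite occ_at_drop.
Qed.

Lemma mem_occs w i : (i \in occs w) = occ_at w i.
Proof.
rewrite mem_filter mem_iota /= add0n; apply/andP/idP => [[]//|h]; split=> //.
by move: h; rewrite occ_atE => /andP[]; lia.
Qed.

Lemma occ_at_size w i : occ_at w i -> i + 5 <= size w.
Proof. by rewrite occ_atE => /andP[]. Qed.

(** An occurrence at [i + d] would have its minimum there and cover position [i + 4], whereas the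
    one at [i] puts entry [i + 4] below entries [i + 1] and [i + 2]. *)
Lemma occ_at_conflict w i d : 0 < d < 3 -> occ_at w i -> ~~ occ_at w (i + d).
Proof.
rewrite !occ_atE => /andP[d0 d3] /and5P[_ h1 h2 h3 h4].
have [->|->] : d = 1 \/ d = 2 by lia.
  have e m : i + 1 + m = i + m.+1 by lia.
  by apply/negP => /and5P[_]; rewrite !e; lia.
have e m : i + 2 + m = i + m.+2 by lia.
by apply/negP => /and5P[_]; rewrite !e; lia.
Qed.

Lemma cluster_occ0 k w : is_cluster k w -> 0 < size w -> occ_at w 0.
Proof.
case/and3P=> _ /allP H _ s0; have /H/hasP[i] : 0 \in iota 0 (size w) by rewrite mem_iota.
by rewrite mem_occs leqn0 => hi /andP[/eqP i0 _]; rewrite -i0.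
Qed.

Lemma cluster0 w : 0 < size w -> ~~ is_cluster 0 w.
Proof.
move=> s0; apply/negP => H; have := cluster_occ0 H s0.
by case/and3P: H => /nilP e _ _; rewrite -mem_occs e.
Qed.

Lemma cluster_drop d k w : 0 < d < 5 -> occ_at w 0 -> occ_at w d ->
    occs w = 0 :: map (addn d) (occs (drop d w)) ->
  is_cluster k.+1 w = is_cluster k (drop d w).
Proof.
move=> /andP[d0 d5] h0 hd E; rewrite /is_cluster E /= size_map eqSS.
have sz := occ_at_size hd.
congr [&& _, _ & _]; last first.
  case E': (occs (drop d w)) => [|j o].
    by have := mem_occs (drop d w) 0; rewrite occ_at_drop addn0 hd E'.
  have -> : j = 0.
    have -> : j = head 0 (occs (drop d w)) by rewrite E'.
    have h : occ_at (drop d w) 0 by rewrite occ_at_drop addn0.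
    rewrite /occs; case: (size _) (occ_at_size h) => // n _ /=.
    by rewrite h.
  rewrite /= addn0 add0n d5 /= -{1}[d]addn0 path_map.
  by apply: eq_path => x y /=; rewrite -addnA ltn_add2l.
rewrite size_drop; apply/allP/allP => H j; rewrite mem_iota add0n => /andP[_ jl].
  have /H : d + j \in iota 0 (size w) by rewrite mem_iota /=; lia.
  (* An entry of the suffix covered by the removed occurrence lies before position 5, so the
     occurrence at [d] covers it as well. *)
  rewrite /= add0n has_map => /orP[jd|].
    apply/hasP; exists 0; first by rewrite mem_occs occ_at_drop addn0.
    lia.
  by case/hasP=> i io /= ij; apply/hasP; exists i => //; lia.
have [jd|dj] := ltnP j 5; first by [].
have /H/hasP[i io ij] : j - d \in iota 0 (size w - d) by rewrite mem_iota /=; lia.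
rewrite /= has_map; apply/hasP; exists i => //=; lia.
Qed.

(* What remains after the run of occurrences at distance 3 has been removed:
   a single entry, or a cluster sharing its first entry with the run. *)
Definition tail_ok k (w : seq nat) := (size w == 1) && (k == 0) || is_cluster k w.

Lemma cluster_size k w : is_cluster k w -> 0 < size w -> 5 <= size w.
Proof. by move=> h /(cluster_occ0 h) /occ_at_size. Qed.

(** The next occurrence is at distance 3 or 4, never both, or there is none and the length is 5. The
    last two cases make up [tail_ok]; the sum of booleans records that the alternatives exclude each
    other. *)
Lemma cluster_peel k w : occ_at w 0 ->
  is_cluster k.+1 w = tail_ok k (drop 4 w) + is_cluster k (drop 3 w) :> nat.
Proof.
move=> h0; have sz := occ_at_size h0; rewrite add0n in sz.
have n1 : occ_at w 1 = false by apply/negbTE/(@occ_at_conflict w 0 1).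
have n2 : occ_at w 2 = false by apply/negbTE/(@occ_at_conflict w 0 2).
have not_cluster d : d < 5 -> d < size w -> ~~ occ_at w d -> is_cluster k (drop d w) = false.
  move=> d5 ds hd; apply/negP => /cluster_occ0.
  by rewrite size_drop subn_gt0 => /(_ ds); rewrite occ_at_drop addn0 (negPf hd).
have [h3|h3] := boolP (occ_at w 3).
  have h4 : ~~ occ_at w 4 by apply: (@occ_at_conflict w 3 1).
  have sz3 := occ_at_size h3.
  rewrite /tail_ok (not_cluster 4) // size_drop.
  rewrite (_ : _ - 4 == 1 = false) /=; last by lia.
  rewrite (@cluster_drop 3) // (@occs_drop 3) /=; last by lia.
  by rewrite h0 n1 n2.
rewrite (not_cluster 3) ?addn0 //; last by lia.
have [h4|h4] := boolP (occ_at w 4).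
  have sz4 := occ_at_size h4.
  rewrite /tail_ok size_drop (_ : _ - 4 == 1 = false) /=; last by lia.
  rewrite (@cluster_drop 4) // (@occs_drop 4) /=; last by lia.
  by rewrite h0 n1 n2 (negPf h3).
rewrite /tail_ok (not_cluster 4) // orbF size_drop; congr nat_of_bool.
(* Any further occurrence would start at position 5 or later and miss the first one; with none,
   covering the last entry forces length 5. *)
have occs5 : occs w = 0 :: map (addn 5) (occs (drop 5 w)).
  by rewrite (@occs_drop 5) //= h0 n1 n2 (negPf h3) (negPf h4).
apply/idP/andP => [/and3P[]|[/eqP s5 /eqP->]].
  rewrite occs5 /=; case: (occs _) => [|j o] /=; last by [].
  rewrite eqSS eq_sym => ->  /allP H _; split=> //.
  have /H : (size w).-1 \in iota 0 (size w) by rewrite mem_iota /=; lia.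
  by rewrite /= orbF; lia.
have s5' : size w = 5 by lia.
by rewrite /is_cluster occs5 drop_oversize ?s5'.
Qed.

(** Inside the first occurrence the pattern decides. A later entry lies in the suffix from position
    3 or 4, which is again a tail by [cluster_peel], and whose head already exceeds entry 0. *)
Lemma tail_head_min k w j : tail_ok k w -> 0 < j < size w -> nth 0 w 0 < nth 0 w j.
Proof.
have [n] := ubnP (size w); elim: n k w j => // n IH k w j; rewrite ltnS => sn.
case/orP=> [/andP[/eqP->]|H]; first by lia.
case/andP=> j0 jn; have h0 : occ_at w 0 by apply: cluster_occ0 H _; lia.
case: k H => [|k H]; first by move=> h; have := @cluster0 w; rewrite h; lia.
have sz := occ_at_size h0.
have : is_cluster k.+1 w = true :> nat by rewrite H.
move: (h0); rewrite occ_atE !add0n => /and5P[_ h1 h2 h3 h4].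
have hj : j < 5 -> nth 0 w 0 < nth 0 w j.
  by case: (j) j0 => [|[|[|[|[|]]]]] //= _ _; lia.
rewrite cluster_peel // => e.
have [/hj//|j5] := ltnP j 5.
case: (boolP (tail_ok k (drop 4 w))) e => [T _|_].
  have := IH _ _ (j - 4) _ T; rewrite !nth_drop size_drop addn0 subnKC; last by lia.
  by move=> /(_ _ _)H'; have := H' ltac:(lia) ltac:(lia); lia.
case: (boolP (is_cluster k (drop 3 w))) => // C _.
have T : tail_ok k (drop 3 w) by rewrite /tail_ok C orbT.
have := IH _ _ (j - 3) _ T; rewrite !nth_drop size_drop addn0 subnKC; last by lia.
by move=> /(_ _ _)H'; have := H' ltac:(lia) ltac:(lia); lia.
Qed.

(** * Decomposition of a cluster by its initial run *)

(** The ascent in the base case is the comparison of entries [3l] and [3l+1]. The last occurrence of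
    a nonempty run implies it; stating it lets inductions start at [l = 0]. *)
Fixpoint run l k (w : seq nat) : bool :=
  match l, k with
  | 0, _ => (nth 0 w 0 < nth 0 w 1) && tail_ok k (drop 1 w)
  | l'.+1, k'.+1 => occ_at w 0 && run l' k' (drop 3 w)
  | _, _ => false
  end.

Lemma run_size l k w : run l k w -> 3 * l + 2 <= size w.
Proof.
elim: l k w => [|l IH] [|k] w //=.
(* Entries out of range read as 0, so the ascent fails on words with fewer than two entries. *)
- by case: w => [|x [|y w]] //=.
- by case: w => [|x [|y w]] //=.
by case/andP=> /occ_at_size sz /IH; rewrite size_drop; lia.
Qed.

(** Iterates [cluster_peel]: distance 3 lengthens the run, and the [tail_ok] branch ends it. A
    boolean equal to this sum means that the length of the run is unique. *)
Lemma cluster_runs k w N : 0 < size w <= N ->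
  is_cluster k w = \sum_(l < N) run l.+1 k w :> nat.
Proof.
elim: N k w => [|N IH] k w; first by lia.
case/andP=> s0 sN; have [h0|h0] := boolP (occ_at w 0); last first.
  rewrite big1 => [|l _]; last by case: k => //= k; rewrite (negPf h0).
  by case: (boolP (is_cluster k w)) => // /cluster_occ0 /(_ s0); rewrite (negPf h0).
have sz := occ_at_size h0.
case: k => [|k]; first by rewrite big1 // (negPf (cluster0 s0)).
rewrite cluster_peel // big_ord_recl; congr (_ + _).
  rewrite /= h0 drop_drop !nth_drop /=.
  by move: h0; rewrite occ_atE => /and5P[_ _ -> _ _].
rewrite (IH k) ?size_drop; last by lia.
by apply: eq_bigr => l _; rewrite lift0 /= h0.
Qed.

(** * From the symmetric group to words, up to relabelling of entries *)

Lemma cluster_count_permutations n k :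
  cluster_count n k = count (is_cluster k) (permutations (iota 0 n)).
Proof.
have sz (p : 'S_n) : size (word p) = n by rewrite size_map size_enum_ord.
have nthw (p : 'S_n) (j : 'I_n) : nth 0 (word p) j = p j.
  by rewrite (nth_map j) ?size_enum_ord // nth_ord_enum.
transitivity (count (fun p : 'S_n => is_cluster k (word p)) (enum {: 'S_n})).
  rewrite /cluster_count cardsE cardE -size_filter; congr size.
  by rewrite !enumT; apply: eq_filter.
apply/esym/(count_bij (f := @word n)); rewrite ?permutations_uniq ?enum_uniq //.
- move=> p q _ _ e; apply/permP => j; apply: val_inj.
  by rewrite /= -!nthw e.
- move=> p _ ->; rewrite andbT mem_permutations; apply: uniq_perm.
  + by rewrite map_inj_uniq ?enum_uniq // => i j /val_inj/perm_inj.
  + exact: iota_uniq.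
  move=> i; rewrite mem_iota add0n /=; apply/mapP/idP => [[j _ ->]|ilt].
    exact: ltn_ord.
  by exists (p^-1%g (Ordinal ilt)); rewrite ?mem_enum // permKV.
move=> w; rewrite mem_permutations => pw Cw.
have sw : size w = n by rewrite (perm_size pw) size_iota.
have lt (j : 'I_n) : nth 0 w j < n.
  have : nth 0 w j \in w by rewrite mem_nth ?sw.
  by rewrite (perm_mem pw) mem_iota.
have inj : injective (fun j => Ordinal (lt j)).
  move=> i j [] /eqP; rewrite nth_uniq ?sw ?(perm_uniq pw) ?iota_uniq //.
  by move=> /eqP/val_inj.
have E : w = word (perm inj).
  apply: (@eq_from_nth _ 0) => [|j]; first by rewrite sz.
  by rewrite sw => jn; rewrite (nthw _ (Ordinal jn)) permE.
by exists (perm inj); rewrite // mem_enum -E.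
Qed.

(** [tail_ok] absorbs the initial conditions, since a nonempty cluster has length at least 5. Length
    0 is excluded because the empty word passes [is_cluster 0]. *)
Lemma s_permutations n k : 0 < n ->
  s n k = count (tail_ok k) (permutations (iota 0 n)).
Proof.
move=> n0; rewrite /s; case: ltnP => n5; last first.
  rewrite cluster_count_permutations; apply: eq_in_count => w.
  rewrite mem_permutations => /perm_size; rewrite size_iota /tail_ok => ->.
  by rewrite (_ : n == 1 = false) //; lia.
rewrite (@eq_in_count _ _ (fun _ => (n == 1) && (k == 0))).
  case: n n0 n5 => [|[|n]] //= _ _; last by rewrite count_pred0.
  by case: eqP => //= _; rewrite ?count_predT ?count_pred0.
move=> w; rewrite mem_permutations => /perm_size; rewrite size_iota /tail_ok => e.
rewrite e; case: (boolP (is_cluster k w)) => [/cluster_size|_]; last by rewrite orbF.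
by rewrite e n0 => /(_ isT); lia.
Qed.

Lemma tail_ok_map (f : nat -> nat) k w :
    {in w &, {mono f : x y / x < y}} ->
  tail_ok k (map f w) = tail_ok k w.
Proof.
move=> fm; rewrite /tail_ok size_map; congr orb.
have occE i : occ_at (map f w) i = occ_at w i.
  rewrite /occ_at size_map; case: leqP => //= sz.
  apply: eq_forallb => a; apply: eq_forallb => b.
  have lt (c : 'I_5) : i + c < size w by apply: leq_trans sz; rewrite ltn_add2l.
  by rewrite !(nth_map 0) // fm // mem_nth.
rewrite /is_cluster size_map (_ : occs (map f w) = occs w) //.
by rewrite /occs size_map; apply: eq_filter.
Qed.

(** Only relative order matters: [nth 0 D], for [D] the sorted entries, is an order isomorphism from
    the ranks to the entries, with inverse [index^~ D]. *)
Lemma count_tail_relabel k C : uniq C ->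
  count (tail_ok k) (permutations C) =
  count (tail_ok k) (permutations (iota 0 (size C))).
Proof.
move=> UC; set D := sort leq C.
have pD : perm_eq D C by rewrite perm_sort.
have UD : uniq D by rewrite (perm_uniq pD).
have sD : sorted ltn D by rewrite ltn_sorted_uniq_leq UD sort_sorted //; apply: leq_total.
rewrite -(seq.permP (perm_permutations pD)) -(perm_size pD).
have mono : {in iota 0 (size D) &, {mono nth 0 D : x y / x < y}}.
  move=> i j; rewrite !mem_iota !add0n /= => ilt jlt.
  have lt a b : b < size D -> a < b -> nth 0 D a < nth 0 D b.
    move=> bs ab; apply: (sorted_ltn_nth ltn_trans _ sD) => //.
    by rewrite inE (ltn_trans ab).
  case: (ltngtP i j) => [ij|ji|->]; rewrite ?ltnn //; first exact: lt.
  by have := lt _ _ ilt ji; lia.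
have ED : D = map (nth 0 D) (iota 0 (size D)) by rewrite map_nth_iota0 // take_size.
apply: (count_bij (f := map (nth 0 D))); rewrite ?permutations_uniq //.
- move=> x y; rewrite !mem_filter !mem_permutations => /andP[_ px] /andP[_ py].
  move=> e; apply: (@eq_from_nth _ 0) => [|i ix].
    by rewrite (perm_size px) (perm_size py).
  have iy : i < size y by rewrite (perm_size py) -(perm_size px).
  have := congr1 (nth 0 ^~ i) e; rewrite /= !(nth_map 0) // => /eqP.
  rewrite nth_uniq // => [/eqP//||].
    by have := mem_nth 0 ix; rewrite (perm_mem px) mem_iota.
  by have := mem_nth 0 iy; rewrite (perm_mem py) mem_iota.
- move=> y; rewrite !mem_permutations => py Ty.
  rewrite tail_ok_map ?Ty ?andbT; first by rewrite {2}ED perm_map.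
  by move=> i j; rewrite !(perm_mem py); apply: mono.
move=> x; rewrite mem_permutations => px Tx.
have ex : x = map (nth 0 D) (map (index^~ D) x).
  rewrite -map_comp -{1}(map_id x); apply/eq_in_map => a ax /=.
  by rewrite nth_index // -(perm_mem px).
have pi : perm_eq (map (index^~ D) x) (iota 0 (size D)).
  rewrite (permPl (perm_map _ px)) {2}ED -map_comp.
  rewrite -{2}(map_id (iota 0 _)) (_ : map _ _ = map id (iota 0 (size D))) //.
  by apply/eq_in_map => i; rewrite mem_iota add0n => /= ilt; rewrite index_uniq.
exists (map (index^~ D) x) => //; rewrite mem_permutations pi /=.
rewrite -(@tail_ok_map (nth 0 D)) -?ex // => i j.
by rewrite !(perm_mem pi); apply: mono.
Qed.

(** By [tail_head_min] every valid arrangement of [c :: C] begins with its minimum [c], so fixing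
    this first entry loses nothing. *)
Lemma count_tail_cons c C k : uniq C -> all (ltn c) C ->
  count (fun v => tail_ok k (c :: v)) (permutations C) = s (size C).+1 k.
Proof.
move=> UC /allP gtC; have UcC : uniq (c :: C).
  by rewrite /= UC andbT; apply/negP => /gtC; rewrite /= ltnn.
rewrite s_permutations // -[(size C).+1]/(size (c :: C)) -count_tail_relabel //.
apply/esym/(count_bij (f := cons c)); rewrite ?permutations_uniq //.
- by move=> x y _ _ [].
- by move=> v; rewrite !mem_permutations perm_cons => -> ->.
move=> w; rewrite mem_permutations => pw Tw.
case: w pw Tw => [/perm_size//|d v] pw Tw.
have ed : d = c.
  have : c \in d :: v by rewrite (perm_mem pw) mem_head.
  rewrite inE => /orP[/eqP//|cv].
  have := @tail_head_min _ _ (index c v).+1 Tw; rewrite /= ltnS index_mem cv nth_index //.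
  move=> /(_ isT) dc; have : d \in c :: C by rewrite -(perm_mem pw) mem_head.
  by rewrite inE => /orP[/eqP//|/gtC /=]; lia.
by exists v; rewrite ?ed // mem_permutations; move: pw Tw; rewrite ed perm_cons => -> ->.
Qed.

(** * Perfect matchings and the double factorial *)

(* With [u = x_1 y_1 x_2 y_2 ... x_l y_l]: [x_1 > x_2 > ... > x_l > t] and
   [x_i < y_i] for all [i]; listing the pairs by decreasing minimum makes [u] a
   perfect matching of its entries. *)
Fixpoint desc_pairs t (u : seq nat) : bool :=
  match u with
  | [::] => true
  | [:: _] => false
  | x :: y :: u' => (head t u' < x < y) && desc_pairs t u'
  end.

Lemma seq2_ind (T : Type) (P : seq T -> Prop) :
    P [::] -> (forall x, P [:: x]) -> (forall x y u, P u -> P (x :: y :: u)) ->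
  forall u, P u.
Proof.
move=> P0 P1 P2 u; have [n] := ubnP (size u); elim: n u => // n IH [|x [|y u]] //= lt.
by apply: P2; apply: IH; lia.
Qed.

(** The recursion reads from the left, but the smallest entry sits in the last pair; once that pair
    is removed, its minimum becomes the new lower bound. *)
Lemma desc_pairs_rcons2 t u x y :
  desc_pairs t (u ++ [:: x; y]) = [&& desc_pairs x u, t < x & x < y].
Proof.
elim/seq2_ind: u => [|a|a b u IH] /=; rewrite ?andbT ?andbF // IH.
by case: u {IH} => [|c u] /=; rewrite -!andbA.
Qed.

Lemma desc_pairs_gt t u : desc_pairs t u -> all (ltn t) u.
Proof.
elim/seq2_ind: u => //= x y u IH /andP[/andP[hx xy] /[dup] D /IH A]; rewrite A.
suff : t < x by lia.
by case: u A hx {IH D} => //= c u /andP[]; lia.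
Qed.

(** The smallest entry [m] opens the last pair. Its partner is any of the [2l+1] other entries, and
    the remaining [2l] entries form a matching above [m]. *)
Lemma count_desc_pairs l t B : uniq B -> all (ltn t) B -> size B = 2 * l ->
  count (desc_pairs t) (permutations B) = odd_dfact l.
Proof.
elim: l t B => [|l IH] t B UB gtB sB.
  by case: B sB {UB gtB} => // _; rewrite /odd_dfact big_ord0.
have pB : perm_eq (sort leq B) B by rewrite perm_sort.
rewrite -(seq.permP (perm_permutations pB)).
case E: (sort leq B) => [|m B']; first by have := perm_size pB; rewrite E /= sB; lia.
rewrite E in pB.
have : sorted ltn (m :: B').
  by rewrite ltn_sorted_uniq_leq (perm_uniq pB) UB -E sort_sorted //; apply: leq_total.
rewrite /= (path_sortedE ltn_trans) => /andP[gtB' _].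
have tm : t < m by apply: (allP gtB); rewrite -(perm_mem pB) mem_head.
have /= /andP[mB' UB'] : uniq (m :: B') by rewrite (perm_uniq pB).
have sB' : size B' = (2 * l).+1 by have := perm_size pB; rewrite /= sB; lia.
(* Here [z] has length [2l+1]: [m] is inserted just before its last entry, the partner. *)
rewrite (count_bij (f := fun z => take (2 * l) z ++ m :: drop (2 * l) z)
  (Q := fun z => desc_pairs m (take (2 * l) z) && predT (drop (2 * l) z)) (t := permutations B'));
  rewrite ?permutations_uniq //.
- rewrite (@count_permutations_split _ _ _ _ predT (odd_dfact l) 1) ?sB' //.
    by rewrite muln1 binSn /odd_dfact big_ord_recr /= mulnC addn1.
  move=> C D pe sC; have UCD : uniq (C ++ D) by rewrite (perm_uniq pe).
  move: UCD; rewrite cat_uniq => /and3P[UC _ UD]; split.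
    apply: IH => //; apply/allP => x xC; apply: (allP gtB').
    by rewrite -(perm_mem pe) mem_cat xC.
  rewrite count_predT size_permutations // (_ : size D = 1) //.
  by have := perm_size pe; rewrite size_cat sC sB'; lia.
- move=> x y; rewrite !mem_filter !mem_permutations.
  move=> /andP[_ /perm_size px] /andP[_ /perm_size py] /eqP.
  have st z : size z = size B' -> size (take (2 * l) z) = 2 * l.
    by move=> sz; rewrite size_takel // sz sB'.
  rewrite eqseq_cat ?st // eqseq_cons eqxx => /andP[/eqP e1 /eqP e2].
  by rewrite -(cat_take_drop (2 * l) x) e1 e2 cat_take_drop.
- move=> z; rewrite !mem_permutations andbT => pz Dz; apply/andP; split.
    rewrite -cat_rcons -cats1 -catA perm_catCA perm_cons cat_take_drop //.
  case Ed: (drop _ z) => [|y [|y' d]]; have := congr1 size Ed;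
    rewrite size_drop (perm_size pz) sB' /=; try lia.
  move=> _; rewrite desc_pairs_rcons2 Dz tm /=; apply: (allP gtB').
  by rewrite -(perm_mem pz) -(cat_take_drop (2 * l) z) Ed mem_cat mem_head orbT.
move=> x; rewrite mem_permutations => px.
have ex := cat_take_drop (2 * l) x; move: ex; set u := take _ x => ex.
have su : size u = 2 * l by rewrite size_takel // (perm_size px) /= sB'; lia.
case Ed: (drop _ x) ex => [|a [|b [|b' d]]]; have := congr1 size Ed;
  rewrite size_drop (perm_size px) /= sB'; try lia.
move=> _ ex; rewrite -ex desc_pairs_rcons2 => /and3P[Du ta ab].
(* Every other entry of the word exceeds [a], so [m] can only be [a] itself. *)
have ea : a = m.
  have /predU1P[//|/(allP gtB') /= ma] : a \in m :: B'.
    by rewrite -(perm_mem px) -ex mem_cat mem_head orbT.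
  have : m \in x by rewrite (perm_mem px) mem_head.
  rewrite -ex mem_cat !inE => /orP[/(allP (desc_pairs_gt Du))/=|]; lia.
rewrite ea in ex Du.
exists (u ++ [:: b]); last by rewrite -su take_size_cat // drop_size_cat // ea.
rewrite -su take_size_cat // Du andbT /= mem_permutations andbT.
rewrite -(perm_cons m) -(permPr px) -ex perm_sym.
by rewrite -[[:: m; b]]/([:: m] ++ [:: b]) perm_catCA.
Qed.

(** * Normal form of a word with a run *)

(* [weave [:: c_0; ...; c_l; c'] [:: x_1; y_1; ...; x_l; y_l] v] is
   [c_0 x_1 y_1 c_1 x_2 y_2 ... c_l c' v]; the last line is the case [u = [::]],
   lengthened so as to be a rearrangement of [c ++ u ++ v] on all inputs. *)
Fixpoint weave (c u v : seq nat) : seq nat :=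
  match c, u with
  | a :: c', x :: y :: u' => a :: x :: y :: weave c' u' v
  | _, _ => c ++ u ++ v
  end.

Lemma perm_weave c u v : perm_eq (weave c u v) (c ++ u ++ v).
Proof.
elim: c u => [|a c IH] [|x [|y u]] //=; rewrite perm_cons.
rewrite perm_sym -[[:: x, y & u ++ v]]/([:: x; y] ++ u ++ v) perm_catCA /=.
by rewrite !perm_cons perm_sym.
Qed.

Lemma weave_inj c u v u' v' : size u < 2 * size c -> size u = size u' ->
  weave c u v = weave c u' v' -> u = u' /\ v = v'.
Proof.
elim: c u u' => [|a c IH] [|x [|y u]] [|x' [|y' u']] //=; try lia.
- by move=> _ _ [] /eqP; rewrite eqseq_cat // eqxx => /eqP.
- by move=> _ _ [] /eqP; rewrite eqseq_cat // eqxx /= eqseq_cons => /andP[/eqP-> /eqP->].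
move=> lt [su] [-> -> /IH[||-> ->]] //; lia.
Qed.

(** When no pair is left, the second entry is the last one of [c]; the default of [head] covers this
    case, as it does in [desc_pairs]. *)
Lemma weave_head2 l c u v : size c = l + 2 -> size u = 2 * l ->
  exists w, weave c u v = [:: head 0 c, head (last 0 c) u & w].
Proof.
case: c => [|a [|b c]] /= sc; try by lia.
case: u => [|x [|y u]] /= su; try by lia.
  case: c sc => [|d c] /= sc; first by exists v.
  by lia.
by exists (y :: weave (b :: c) u v).
Qed.

(** An occurrence at the start of [a x y b x' ...] reads [a < b < x' < x < y]. The first two
    comparisons follow from the hypotheses on [c] and [u]; the others are one step of
    [desc_pairs]. *)
Lemma run_weave l k c u v :
    size c = l + 2 -> size u = 2 * l -> sorted ltn c -> all (ltn (last 0 c)) u ->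
  run l k (weave c u v) =
  [&& l <= k, desc_pairs (last 0 c) u & tail_ok (k - l) (last 0 c :: v)].
Proof.
elim: l k c u => [|l IH] k [|a [|b c]] [|x [|y u]] /= sc su; try by lia.
  by case: c sc => // _; rewrite /= andbT ?drop0 subn0 => -> _.
case: k => [|k] // /andP[ab path_c] /and3P[gx gy gu].
have bl : b < last b c.
  move: path_c; rewrite (path_sortedE ltn_trans) => /andP[/allP lt _]; apply: lt.
  by case: (c) sc => [|d c' _] /=; [lia | apply: mem_last].
have [| |w ew] := @weave_head2 l (b :: c) u v; [by move: sc => /=; lia | lia |].
have Rw := IH k (b :: c) u _ _ path_c gu.
rewrite drop0 subSS ltnS Rw ?occ_atE -/(weave (b :: c) u v) ?ew /=;
  [|by move: sc => /=; lia|lia].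
have -> : b < head (last b c) u by case: (u) gu => //= d u' /andP[]; lia.
rewrite ab /=; case: (l <= k); rewrite ?andbF //=.
by rewrite -!andbA.
Qed.

(** Here [c] collects the entries at [0, 3, ..., 3l, 3l+1]. The tail exceeds its own head, the last
    entry of [c], by [tail_head_min]; the pairs exceed it because their minima decrease towards
    it. *)
Lemma run_weaveP l k w : run l k w ->
  exists c u v, [/\ w = weave c u v, size c = l + 2, size u = 2 * l,
    sorted ltn c & all (ltn (last 0 c)) (u ++ v)].
Proof.
elim: l k w => [|l IH] k w /=.
  case: w => [|a [|b v]] //=; rewrite ?drop0 => /andP[ab T].
  exists [:: a; b], [::], v; split; rewrite //= ?ab //.
  apply/(all_nthP 0) => i iv; exact: (@tail_head_min _ _ i.+1 T).
case: k => // k /andP[]; rewrite occ_atE => /and5P[sz h1 h2 h3 h4].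
case: w sz h1 h2 h3 h4 => [|a [|x [|y w]]] //= sz h1 h2 h3 h4.
rewrite drop0 => /IH[c [u [v [ew sc su ltc /allP gt]]]].
have [w' ew'] := weave_head2 v sc su.
rewrite ew ew' /= in h1 h2 h3 h4.
case: c => [|b c] in sc ltc gt ew ew' h1 h2 h3 h4 *; first by move: sc => /=; lia.
rewrite /= in ltc gt h1 h2 h3 h4.
have gtx : last b c < x.
  by case: (u) gt h3 => //= z u' /(_ z); rewrite mem_head => /(_ isT) /=; lia.
exists [:: a, b & c], [:: x, y & u], v; split=> //=.
- by rewrite ew.
- by move: sc => /=; lia.
- by lia.
- by rewrite h1.
by rewrite gtx (ltn_trans gtx h4); apply/allP.
Qed.

(** * Counting runs and summing over their lengths *)

Lemma count_run n l k : 3 * l + 2 <= n ->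
  count (run l k) (permutations (iota 0 n)) =
  'C(n - l - 2, 2 * l) * odd_dfact l *
    (if l <= k then s (n - 3 * l - 1) (k - l) else 0).
Proof.
move=> ln; set c := iota 0 (l + 2); set A := iota (l + 2) (n - l - 2).
have sc : size c = l + 2 by rewrite size_iota.
have sA : size A = n - l - 2 by rewrite size_iota.
have UA : uniq A by rewrite iota_uniq.
have lc : last 0 c = l.+1.
  by rewrite -nth_last sc nth_iota; lia.
have ltc : sorted ltn c by apply: iota_ltn_sorted.
have iotaE : iota 0 n = c ++ A by rewrite -iotaD; congr iota; lia.
have gtA x : x \in A -> l.+1 < x by rewrite mem_iota; lia.
have st z : perm_eq z A -> size (take (2 * l) z) = 2 * l.
  by move=> /perm_size sz; rewrite size_takel // sz sA; lia.
case: leqP => [lk|kl]; last first.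
  rewrite muln0; apply/eqP; rewrite -leqn0 leqNgt -has_count; apply/hasP => -[w _].
  move=> /[dup] Rw /run_weaveP[c' [u [v [ew sc' su ltc' gt]]]]; move: Rw.
  rewrite ew run_weave //; first by lia.
  by move: gt; rewrite all_cat => /andP[].
rewrite -sA -(@count_permutations_split _ A (2 * l) (desc_pairs l.+1)
   (fun v => tail_ok (k - l) (l.+1 :: v))) ?sA //; last by lia.
- apply: (count_bij (f := fun z => weave c (take (2 * l) z) (drop (2 * l) z)));
    rewrite ?permutations_uniq //.
  + move=> x y; rewrite !mem_filter !mem_permutations => /andP[_ px] /andP[_ py].
    move=> /weave_inj; rewrite sc !st // => /(_ ltac:(lia) erefl) [e1 e2].
    by rewrite -(cat_take_drop (2 * l) x) e1 e2 cat_take_drop.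
  + move=> z; rewrite !mem_permutations => pz Qz.
    rewrite run_weave ?st ?lc ?lk ?Qz ?andbT //.
      by rewrite (permPl (perm_weave _ _ _)) iotaE perm_cat2l cat_take_drop.
    apply/allP => x /mem_take; rewrite (perm_mem pz); exact: gtA.
  move=> w; rewrite mem_permutations => pw.
  move=> /[dup] Rw /run_weaveP[c' [u [v [ew sc' su ltc' gt]]]].
  have pc : perm_eq (c' ++ sort leq (u ++ v)) (c ++ A).
    rewrite -iotaE -(permPr pw) ew (permPr (perm_weave _ _ _)) perm_cat2l.
    by rewrite perm_sort.
  (* Since [c'] is increasing and lies below all of [u ++ v], both sides are sorted lists of the
     same entries; hence [c'] consists of the [l+2] smallest values. *)
  have : c' ++ sort leq (u ++ v) = c ++ A.
    apply: (sorted_eq leq_trans anti_leq) => //; last first.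
      by rewrite -iotaE; apply: iota_sorted.
    have ltc'' : sorted leq c' by apply: sub_sorted ltc' => x y /ltnW.
    case: c' sc' ltc'' gt {ltc' ew pc} => [|a c'] /=; first by lia.
    move=> _ pc' gt; rewrite cat_path pc' /= path_sortedE; last exact: leq_trans.
    rewrite sort_sorted ?andbT; last exact: leq_total.
    by rewrite all_sort; apply: sub_all gt => x /ltnW.
  move=> /eqP; rewrite eqseq_cat ?sc // => /andP[/eqP ec /eqP eA]; subst c'.
  have puv : perm_eq (u ++ v) A by rewrite -eA perm_sym perm_sort.
  exists (u ++ v); last by rewrite -su take_size_cat // drop_size_cat.
  rewrite mem_permutations puv -su take_size_cat // drop_size_cat //=.
  move: Rw; rewrite ew run_weave // ?lc ?lk //=.
  by move: gt; rewrite all_cat lc => /andP[].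
move=> B C pe sB; have : uniq (B ++ C) by rewrite (perm_uniq pe).
have gt x : x \in B ++ C -> l.+1 < x by rewrite (perm_mem pe); apply: gtA.
rewrite cat_uniq => /and3P[UB _ UC]; split.
  by apply: count_desc_pairs => //; apply/allP => x xB; apply: gt; rewrite mem_cat xB.
rewrite count_tail_cons //.
  (* The tail shares the entry [l+1] with the run, so its length is [(n-l-2-2l)+1 = n-3l-1]. *)
  congr s; have := perm_size pe; rewrite size_cat sA; lia.
by apply/allP => x xC; apply: gt; rewrite mem_cat xC orbT.
Qed.

Theorem theorem3p6 (n k : nat) : 5 <= n ->
  s n k = \sum_(l < n.+1 | 5 <= 3 * l + 2 <= n)
            'C(n - l - 2, 2 * l) * odd_dfact l *
            (if l <= k then s (n - 3 * l - 1) (k - l) else 0).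
Proof.
move=> n5; have -> : s n k = cluster_count n k by rewrite /s ltnNge n5.
rewrite cluster_count_permutations count_sum.
transitivity (\sum_(w <- permutations (iota 0 n)) \sum_(l < n) run l.+1 k w).
  rewrite [LHS]big_seq [RHS]big_seq; apply: eq_bigr => w.
  rewrite mem_permutations => /perm_size; rewrite size_iota => sw.
  by apply: cluster_runs; rewrite sw; lia.
(* The index [l = 0] fails [5 <= 3l+2] and contributes 0; splitting it off aligns the other indices
   with runs of length [l+1]. *)
rewrite exchange_big [RHS]big_mkcond [RHS]big_ord_recl -[LHS]add0n.
congr (_ + _); apply: eq_bigr => l _.
rewrite lift0 -count_sum; case: ifP => ln; first by apply: count_run; lia.
(* Only the upper bound on the index can fail here, and then the word is too short for the run. *)
apply/eqP; rewrite -leqn0 leqNgt -has_count; apply/hasP => -[w].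
by rewrite mem_permutations => /perm_size; rewrite size_iota => sw /run_size; rewrite sw; lia.
Qed.
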